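(* Let $(X,\mathcal{B})$ be a premeasurable space, let $F'_{\mathcal{B}},G':\mathbf{Set}_c^f\to\mathbf{Pos}$ be the functors described in the context, let $M(X,\mathcal{B})$ be the poset of premeasures on $(X,\mathcal{B})$ and let $[F'_{\mathcal{B}},G']_s$ be the poset of strict transformations $F'_{\mathcal{B}}\to G'$. For a premeasure $\mu$ and a countable set $A$ define $\tau^\mu_A:F'_{\mathcal{B}}A\to G'A$ by $\tau^\mu_A((B_a)_{a\in A})=(\mu(B_a))_{a\in A}$. Then $\mu\mapsto\tau^\mu=(\tau^\mu_A)_A$ defines an isomorphism of posets $\tau^{(-)}:M(X,\mathcal{B})\to[F'_{\mathcal{B}},G']_s$.
   Context: A premeasurable space is a set $X$ with an algebra $\mathcal{B}$ of subsets (closed under finite unions and complements). A premeasure on $(X,\mathcal{B})$ is a map $\mu:\mathcal{B}\to[0,\infty]$ with $\mu(\emptyset)=0$ and $\mu\left(\bigcup_{n=1}^\infty B_n\right)=\sum_{n=1}^\infty\mu(B_n)$ for all pairwise disjoint $(B_n)_{n\ge1}$ in $\mathcal{B}$ with $\bigcup_nB_n\in\mathcal{B}$. $M(X,\mathcal{B})$ is ordered by $\mu_1\le\mu_2$ iff $\mu_1(B)\le\mu_2(B)$ for all $B\in\mathcal{B}$. For a countable (possibly finite) set $A$, $\mathcal{P}_f(A)$ is the algebra of finite and cofinite subsets. A map $f:A\to B$ of countable sets is finite if $f^{-1}(B')\in\mathcal{P}_f(A)$ for all $B'\in\mathcal{P}_f(B)$. $\mathbf{Set}_c^f$ is the category of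 countable sets and finite maps, viewed as a poset-enriched category with discrete hom-posets. $\mathbf{Pos}$ is the category of posets and order-preserving maps, enriched over itself. $F'_{\mathcal{B}}A$ is the discrete poset of maps $g:X\to A$ with $g^{-1}(A')\in\mathcal{B}$ for all $A'\in\mathcal{P}_f(A)$, and $F'_{\mathcal{B}}f$ is postcomposition with $f$; identifying $g$ with $(g^{-1}(\{a\}))_{a\in A}$, $F'_{\mathcal{B}}A$ is the set of $A$-indexed partitions $(B_a)_{a\in A}$ of $X$ into (possibly empty) elements of $\mathcal{B}$ and $F'_{\mathcal{B}}f((B_a)_a)=\left(\bigcup_{f(a)=b}B_a\right)_b$. $G'A=[0,\infty]^A$ with pointwise order and $G'f((p_a)_a)=\left(\sum_{f(a)=b}p_a\right)_{b\in B}$. A strict transformation $\tau:F'_{\mathcal{B}}\to G'$ is a family of order-preserving maps $\tau_A:F'_{\mathcal{B}}A\to G'A$ with $G'f\circ\tau_A=\tau_B\circ F'_{\mathcal{B}}f$ for all morphisms $f:A\to B$; these are ordered pointwise. *)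

(* Defs.v *)
From HB Require Import structures.
From mathcomp Require Import all_boot all_order all_algebra.
From mathcomp Require Import all_classical all_reals all_analysis.

Set Implicit Arguments.
Unset Strict Implicit.
Unset Printing Implicit Defensive.

Import Order.TTheory GRing.Theory Num.Theory.

Local Open Scope classical_set_scope.
Local Open Scope ring_scope.

Definition fin_cofin (A : Type) : set (set A) :=
  [set S | finite_set S \/ finite_set (~` S)].

(* As usual in the library, finite (and empty) types are countable.
   Quantifying over [countType] instead would put strict transformations in too
   large a universe for them to form a [porderType]. *)
Record countable_set := CountableSet {
  carrier :> Type;
  countable_carrier : countable [set: carrier] }.

HB.instance Definition _ (A : countable_set) := gen_eqMixin (carrier A).
HB.instance Definition _ (A : countable_set) := gen_choiceMixin (carrier A).

Record finite_map (A B : countable_set) := FiniteMap {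
  finite_map_fun :> A -> B;
  finite_mapP : forall S, fin_cofin S -> fin_cofin (finite_map_fun @^-1` S) }.

Definition finite_map_id (A : countable_set) : finite_map A A :=
  @FiniteMap A A idfun (fun _ fS => fS).

Definition finite_map_comp (A B C : countable_set)
    (h : finite_map B C) (f : finite_map A B) : finite_map A C :=
  @FiniteMap A C (h \o f) (fun _ fS => finite_mapP f (finite_mapP h fS)).

(* The hom-posets of the source are discrete, so that compatibility with the
   enrichment imposes no condition on [mor]. *)
Record pos_functor (d : Order.disp_t) := PosFunctor {
  ob :> countable_set -> porderType d;
  mor : forall A B : countable_set, finite_map A B -> ob A -> ob B;
  mor_homo : forall (A B : countable_set) (f : finite_map A B),
    {homo mor f : x y / (x <= y)%O};
  mor_id : forall (A : countable_set) (x : ob A), mor (finite_map_id A) x = x;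
  mor_comp : forall (A B C : countable_set) (h : finite_map B C)
      (f : finite_map A B) (x : ob A),
    mor (finite_map_comp h f) x = mor h (mor f x) }.

Record strict_trans (d d' : Order.disp_t) (F : pos_functor d)
    (G : pos_functor d') := StrictTrans {
  trans_fun :> forall A : countable_set, F A -> G A;
  trans_homo : forall A : countable_set, {homo @trans_fun A : x y / (x <= y)%O};
  trans_natural : forall (A B : countable_set) (f : finite_map A B) (x : F A),
    mor f (trans_fun x) = trans_fun (mor f x) }.

Arguments trans_fun {d d' F G} _ A _.

Section strict_trans_order.
Context (d d' : Order.disp_t) (F : pos_functor d) (G : pos_functor d').
Local Notation T := (strict_trans F G).
Implicit Types s t : T.

Lemma strict_trans_ext s t : (forall A x, s A x = t A x) -> s = t.
Proof.
case: s t => [s hs ns] [t ht nt] /= st.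
have {}st : s = t by apply: functional_extensionality_dep => A; exact/funext.
by subst t; congr StrictTrans; exact: Prop_irrelevance.
Qed.

HB.instance Definition _ := gen_eqMixin T.
HB.instance Definition _ := gen_choiceMixin T.

Definition le_strict_trans s t : bool :=
  `[< forall (A : countable_set) (x : F A), (s A x <= t A x)%O >].

Let le_refl : reflexive le_strict_trans.
Proof. by move=> s; apply/asboolP. Qed.

Let le_anti : antisymmetric le_strict_trans.
Proof.
move=> s t /andP[/asboolP st /asboolP ts]; apply: strict_trans_ext => A x.
by apply/eqP; rewrite eq_le st ts.
Qed.

Let le_trans : transitive le_strict_trans.
Proof.
move=> t s u /asboolP st /asboolP tu; apply/asboolP => A x.
exact: Order.POrderTheory.le_trans (st A x) (tu A x).
Qed.

HB.instance Definition _ := Order.Le_isPOrder.Build Order.default_display T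
  le_refl le_anti le_trans.

End strict_trans_order.

Definition poset_iso (d d' : Order.disp_t) (P : porderType d)
    (Q : porderType d') (f : P -> Q) : Prop :=
  {homo f : x y / (x <= y)%O} /\
  exists g : Q -> P,
    [/\ {homo g : x y / (x <= y)%O}, cancel f g & cancel g f].

Record ennreal (R : realType) := ENNReal {
  ennval :> \bar R;
  ennval_ge0 : (0 <= ennval)%E }.

Section ennreal_order.
Context (R : realType).

HB.instance Definition _ := [isSub of ennreal R for @ennval R].
HB.instance Definition _ := [Choice of ennreal R by <:].
HB.instance Definition _ :=
  [SubChoice_isSubPOrder of ennreal R by <: with ring_display].

End ennreal_order.

Definition set_algebra (X : Type) (B : set (set X)) : Prop :=
  [/\ B set0, setU_closed B & setC_closed B].

(* [B] is coerced to the type of its elements, so that a premeasure is defined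
   on the members of the algebra only. *)
Record premeasure (R : realType) (X : Type) (B : set (set X)) := Premeasure {
  premeasure_fun :> B -> ennreal R;
  premeasure0 : forall E : B, val E = set0 -> (premeasure_fun E = 0 :> \bar R)%E;
  premeasure_sigma_additive : forall (E : nat -> B) (U : B),
    trivIset setT (fun n => val (E n)) -> val U = \bigcup_n val (E n) ->
    (premeasure_fun U = \sum_(n <oo) premeasure_fun (E n) :> \bar R)%E }.

Section premeasure_order.
Context (R : realType) (X : Type) (B : set (set X)).
Local Notation T := (premeasure R B).
Implicit Types mu nu : T.

Lemma premeasure_ext mu nu : (forall E, mu E = nu E) -> mu = nu.
Proof.
case: mu nu => [mu mu0 muS] [nu nu0 nuS] /= /funext mn; subst nu.
by congr Premeasure; exact: Prop_irrelevance.
Qed.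

HB.instance Definition _ := gen_eqMixin T.
HB.instance Definition _ := gen_choiceMixin T.

Definition le_premeasure mu nu : bool :=
  `[< forall E : B, (mu E <= nu E)%O >].

Let le_refl : reflexive le_premeasure.
Proof. by move=> mu; apply/asboolP. Qed.

Let le_anti : antisymmetric le_premeasure.
Proof.
move=> mu nu /andP[/asboolP mn /asboolP nm]; apply: premeasure_ext => E.
by apply/eqP; rewrite eq_le mn nm.
Qed.

Let le_trans : transitive le_premeasure.
Proof.
move=> nu mu la /asboolP mn /asboolP nl; apply/asboolP => E.
exact: Order.POrderTheory.le_trans (mn E) (nl E).
Qed.

HB.instance Definition _ := Order.Le_isPOrder.Build Order.default_display T
  le_refl le_anti le_trans.

End premeasure_order.

(* A partition [(B_a)_a] is represented by the map [g] with [B_a = g^-1(a)]. *)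
Record partition_map (X : Type) (B : set (set X)) (A : countable_set) :=
  PartitionMap {
    partition_map_fun :> X -> A;
    partition_mapP : forall S, fin_cofin S -> B (partition_map_fun @^-1` S) }.

Section partition_functor.
Context (X : Type) (B : set (set X)).

Section discrete_order.
Context (A : countable_set).
Local Notation T := (partition_map B A).

Lemma partition_map_ext (g h : T) : g =1 h -> g = h.
Proof.
case: g h => [g gP] [h hP] /= /funext gh; subst h.
by congr PartitionMap; exact: Prop_irrelevance.
Qed.

HB.instance Definition _ := gen_eqMixin T.
HB.instance Definition _ := gen_choiceMixin T.

Definition le_partition_map (g h : T) : bool := g == h.

Let le_refl : reflexive le_partition_map.
Proof. exact: eqxx. Qed.

Let le_anti : antisymmetric le_partition_map.
Proof. by move=> g h /andP[/eqP]. Qed.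

Let le_trans : transitive le_partition_map.
Proof. by move=> h g k /eqP-> /eqP->; exact: eqxx. Qed.

HB.instance Definition _ := Order.Le_isPOrder.Build Order.default_display T
  le_refl le_anti le_trans.

Lemma block_subproof (g : T) (a : A) : g @^-1` [set a] \in B.
Proof. by apply/mem_set/(partition_mapP g); left; exact: finite_set1. Qed.

Definition block (g : T) (a : A) : B := SigSub (block_subproof g a).

End discrete_order.

Definition partition_map_mor (A A' : countable_set) (f : finite_map A A')
    (g : partition_map B A) : partition_map B A' :=
  @PartitionMap X B A' (f \o g)
    (fun _ fS => partition_mapP g (finite_mapP f fS)).

Let mor_homo (A A' : countable_set) (f : finite_map A A') :
  {homo partition_map_mor f : g h / (g <= h)%O}.
Proof. by move=> g h /eqP ->. Qed.

Let mor_id (A : countable_set) (g : partition_map B A) :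
  partition_map_mor (finite_map_id A) g = g.
Proof. exact: partition_map_ext. Qed.

Let mor_comp (A A' A'' : countable_set) (h : finite_map A' A'')
    (f : finite_map A A') (g : partition_map B A) :
  partition_map_mor (finite_map_comp h f) g =
  partition_map_mor h (partition_map_mor f g).
Proof. exact: partition_map_ext. Qed.

Definition partition_functor : pos_functor Order.default_display :=
  PosFunctor mor_homo mor_id mor_comp.

End partition_functor.

Section weight_functor.
Context (R : realType).

(* [A -> ennreal R] carries the library's pointwise order on functions. *)
Definition weight_ob (A : countable_set) : porderType FunOrder.fun_display :=
  (A -> ennreal R : porderType _).

Lemma weight_mor_subproof (A A' : countable_set) (f : A -> A')
    (p : A -> ennreal R) (b : A') :
  (0 <= \esum_(a in f @^-1` [set b]) p a)%E.
Proof. by apply: esum_ge0 => a _; exact: ennval_ge0. Qed.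

Definition weight_mor (A A' : countable_set) (f : finite_map A A')
    (p : weight_ob A) : weight_ob A' :=
  fun b => ENNReal (weight_mor_subproof f p b).

Let mor_homo (A A' : countable_set) (f : finite_map A A') :
  {homo weight_mor f : p q / (p <= q)%O}.
Proof.
move=> p q /lefP pq; apply/lefP => b; rewrite leEsub /=.
by apply: le_esum => a _; have := pq a; rewrite leEsub.
Qed.

Let mor_id (A : countable_set) (p : weight_ob A) :
  weight_mor (finite_map_id A) p = p.
Proof.
apply/funext => a; apply: val_inj => /=.
by rewrite preimage_id esum_set1 //; exact: ennval_ge0.
Qed.

Let mor_comp (A A' A'' : countable_set) (h : finite_map A' A'')
    (f : finite_map A A') (p : weight_ob A) :
  weight_mor (finite_map_comp h f) p = weight_mor h (weight_mor f p).
Proof.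
apply/funext => c; apply: val_inj => /=.
rewrite esum_esum; last by move=> *; exact: ennval_ge0.
rewrite [RHS](@reindex_esum _ _ _ ((h \o f) @^-1` [set c]) _
  (fun a => (f a, a))) //.
split=> [a /= hfa //|a a' _ _ [_ //]|[b a] /= [hb fa]].
by exists a; rewrite /= fa.
Qed.

Definition weight_functor : pos_functor FunOrder.fun_display :=
  PosFunctor mor_homo mor_id mor_comp.

End weight_functor.

Definition premeasure_family (R : realType) (X : Type) (B : set (set X))
    (mu : premeasure R B) (A : countable_set) (g : partition_functor B A) :
    weight_functor R A :=
  fun a => mu (block g a).

(* Main.v *)
Require Import Defs.
From mathcomp Require Import all_boot all_order all_algebra.
From mathcomp Require Import all_classical all_reals all_analysis.

(** A set [E] of the algebra is the same thing as its indicator, a partition of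
    [X] indexed by the two-point set, so a strict transformation [s] yields the
    set function sending [E] to the weight of [true] under [s] at the indicator
    of [E]. Naturality along the indicator [A -> bool] of a finite or cofinite
    [S] says that the set function is additive over the blocks of a partition
    with labels in [S]. Taking [S] empty gives the value [0] at the empty
    set, the cofinite set of positive integers gives sigma-additivity, and a
    singleton recovers [s] from the set function. *)

Set Implicit Arguments.
Unset Strict Implicit.
Unset Printing Implicit Defensive.

Import Order.TTheory GRing.Theory Num.Theory.

Local Open Scope classical_set_scope.
Local Open Scope ring_scope.

(** The preimage is [set0], [S] or one of their complements, according to which booleans lie in [P].
    This serves both for [fin_cofin] and for the algebra [B]. *)
Lemma preimage_asbool_closed (T : Type) (C : set (set T)) (S : set T)
    (P : set bool) :
  C set0 -> setC_closed C -> C S -> C ((fun x => `[< S x >]) @^-1` P).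
Proof.
move=> C0 CC CS.
have [Pt|Pt] := pselect (P true); have [Pf|Pf] := pselect (P false).
- rewrite (_ : _ @^-1` _ = ~` set0); first exact: CC.
  by apply/seteqP; split=> [x _ []//|x _ /=]; case: asboolP.
- rewrite (_ : _ @^-1` _ = S) //.
  by apply/seteqP; split=> x /=; case: asboolP.
- rewrite (_ : _ @^-1` _ = ~` S); first exact: CC.
  by apply/seteqP; split=> x /=; case: asboolP.
- rewrite (_ : _ @^-1` _ = set0) //.
  by apply/seteqP; split=> x //=; case: asboolP.
Qed.

Lemma fin_cofin0 (A : Type) : fin_cofin (@set0 A).
Proof. by left. Qed.

Lemma fin_cofin1 (A : Type) (a : A) : fin_cofin [set a].
Proof. by left; exact: finite_set1. Qed.

Lemma fin_cofinC (A : Type) : setC_closed (@fin_cofin A).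
Proof. by move=> S [fS|fS]; [right; rewrite setCK|left]. Qed.

Definition bool_set : countable_set := @CountableSet bool (countableP _).

Definition nat_set : countable_set := @CountableSet nat (countableP _).

Definition indicator_map (A : countable_set) (S : set A) (fS : fin_cofin S) :
    finite_map A bool_set :=
  @FiniteMap A bool_set (fun a => `[< S a >]) (fun P _ =>
    preimage_asbool_closed P (@fin_cofin0 A) (@fin_cofinC A) fS).

Section premeasure_strict_trans.
Context (R : realType) (X : Type) (B : set (set X)).

(** An injection of the labels into [nat] turns the blocks over [S] into a disjoint sequence with
    union [E], so sigma-additivity applies. With [S] a fibre of a finite map, this is naturality. *)
Lemma premeasure_preimage (mu : premeasure R B) (A : countable_set)
    (g : partition_map B A) (S : set A) (E : B) :
  val E = g @^-1` S -> (mu E = \esum_(a in S) mu (block g a) :> \bar R)%E.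
Proof.
move=> ES; have /countable_injP[f /in2TT f_inj] := countable_carrier A.
(* Each [F n] is a singleton, or empty when [n] numbers no label of [S]; the empty ones contribute
   [0] on both sides. *)
pose F n := [set a | S a /\ f a = n].
have tF : trivIset setT F by move=> i j _ _ [a [[_ <-] [_ <-]]].
have BF n : g @^-1` F n \in B.
  apply/mem_set/(partition_mapP g); left.
  have [[a [_ <-]]|F0] := pselect (F n !=set0).
    by apply: sub_finite_set (finite_set1 a) => b [_ /f_inj].
  rewrite (_ : F n = set0)//.
  by apply/seteqP; split=> // a Fa; case: F0; exists a.
rewrite (premeasure_sigma_additive mu (E := fun n => SigSub (BF n))); first last.
- rewrite ES; apply/seteqP; split=> [x Sx|x [n _ [Sx]] //].
  by exists (f (g x)).
- by move=> i j _ _ [x [Fi Fj]]; apply: tF => //; exists (g x).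
rewrite (_ : S = \bigcup_n F n); last first.
  by apply/seteqP; split=> [a Sa|a [n _ []]]//; exists (f a).
rewrite nneseries_sum_bigcup; first last.
- by move=> a; exact: ennval_ge0.
- exact: tF.
apply: eq_eseriesr => n _.
have [[a [Sa fa]]|F0] := pselect (F n !=set0).
  have Fn : F n = [set a].
    by apply/seteqP; split=> [b [_]|_ ->]//; rewrite -fa => /f_inj.
  rewrite [X in (\esum_(_ in X) _)%E]Fn esum_set1; last exact: ennval_ge0.
  by congr (ennval (mu _)); apply: val_inj => /=; rewrite Fn.
have {}F0 : F n = set0.
  by apply/seteqP; split=> // a Fa; case: F0; exists a.
rewrite [X in (\esum_(_ in X) _)%E]F0 esum_set0.
by apply: premeasure0 => /=; rewrite F0 preimage_set0.
Qed.

Lemma premeasure_family_homo (mu : premeasure R B) (A : countable_set) :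
  {homo @premeasure_family R X B mu A : g h / (g <= h)%O}.
Proof. by move=> g h /eqP->. Qed.

Lemma premeasure_family_natural (mu : premeasure R B) (A A' : countable_set)
    (f : finite_map A A') (g : partition_functor B A) :
  mor f (premeasure_family mu g) = premeasure_family mu (mor f g).
Proof. by apply/funext => b; apply/val_inj/esym/premeasure_preimage. Qed.

Definition premeasure_trans (mu : premeasure R B) :
    strict_trans (partition_functor B) (weight_functor R) :=
  StrictTrans (@premeasure_family_homo mu) (@premeasure_family_natural mu).

Context (algB : set_algebra B).

Lemma indicator_subproof (E : B) (P : set bool) :
  B ((fun x => `[< val E x >]) @^-1` P).
Proof.
by have [B0 _ BC] := algB; apply: preimage_asbool_closed => //; exact: set_valP.
Qed.

Definition indicator (E : B) : partition_map B bool_set :=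
  @PartitionMap X B bool_set (fun x => `[< val E x >])
    (fun P _ => indicator_subproof E P).

(** Through this identity a premeasure is recovered from its transformation. *)
Lemma block_indicator (E : B) : block (indicator E) true = E.
Proof.
apply: val_inj; apply/seteqP.
by split=> x /=; [move/asboolP|move=> ?; exact/asboolP].
Qed.

(** A finite [S] gives a finite union of fibres, a cofinite one the complement of such a union. *)
Lemma fibers_preimage (A : Type) (g : X -> A) (S : set A) :
  (forall a, B (g @^-1` [set a])) -> fin_cofin S -> B (g @^-1` S).
Proof.
have [B0 BU BC] := algB => Bg.
have fin P : finite_set P -> B (g @^-1` P).
  move=> finP; rewrite (_ : _ @^-1` _ = \bigcup_(a in P) g @^-1` [set a]).
    by apply: (fin_bigcup_closedP B).1.
  apply/seteqP; split=> [x Px|x [a Pa /= gx]]; first by exists (g x).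
  by rewrite /preimage /= gx.
case=> [/fin //|/fin]; rewrite preimage_setC => /BC.
by rewrite setCK.
Qed.

Section premeasure_of_trans.
Context (s : strict_trans (partition_functor B) (weight_functor R)).

Definition trans_measure (E : B) : ennreal R := s bool_set (indicator E) true.

Lemma trans_measure_preimage (A : countable_set) (g : partition_functor B A)
    (S : set A) (E : B) :
  fin_cofin S -> val E = g @^-1` S ->
  (trans_measure E = \esum_(a in S) s A g a :> \bar R)%E.
Proof.
move=> fS ES; rewrite /trans_measure.
(* Both partitions label [x] by whether [g x] lies in [S]. *)
have -> : indicator E = mor (indicator_map fS) g.
  by apply: partition_map_ext => x /=; rewrite ES.
rewrite -trans_natural /= (_ : _ @^-1` _ = S) //.
by apply/seteqP; split=> a /=; [move/asboolP|move=> ?; exact/asboolP].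
Qed.

Lemma trans_measure_block (A : countable_set) (g : partition_functor B A)
    (a : A) :
  trans_measure (block g a) = s A g a.
Proof.
apply: val_inj => /=; rewrite (@trans_measure_preimage A g [set a])//.
  by rewrite esum_set1//; exact: ennval_ge0.
exact: fin_cofin1.
Qed.

Lemma trans_measure0 (E : B) :
  val E = set0 -> (trans_measure E = 0 :> \bar R)%E.
Proof.
move=> E0.
rewrite (@trans_measure_preimage _ (indicator E) set0) ?esum_set0//.
exact: fin_cofin0.
Qed.

(* The label [n.+1] is given to [E n] and the label [0] to the complement of
   the union. *)
Lemma trans_measure_sigma_additive (E : nat -> B) (U : B) :
  trivIset setT (fun n => val (E n)) -> val U = \bigcup_n val (E n) ->
  (trans_measure U = \sum_(n <oo) trans_measure (E n) :> \bar R)%E.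
Proof.
move=> tE UE; have [_ _ BC] := algB.
pose g x : nat := if pselect (exists n, val (E n) x) is left h
  then (projT1 (cid h)).+1 else 0%N.
have gS n : g @^-1` [set n.+1] = val (E n).
  apply/seteqP; split=> x /=; rewrite /g; case: pselect => // h.
    by case: (cid h) => m Em /= [<-].
  (* Disjointness forces the chosen index [m] to be [n]. *)
  move=> Enx; case: (cid h) => m Em /=; congr _.+1.
    by apply: tE => //; exists x.
  by move=> Enx; case: h; exists n.
have g0 : g @^-1` [set 0%N] = ~` val U.
  rewrite UE; apply/seteqP; split=> x /=; rewrite /g; case: pselect => //.
  - by move=> h _ [n _ Enx]; case: h; exists n.
  - by move=> [n Enx] []; exists n.
have Bg (k : nat) : B (g @^-1` [set k]).
  by case: k => [|n]; [rewrite g0; apply: BC|rewrite gS]; exact: set_valP.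
pose G : partition_functor B nat_set :=
  @PartitionMap X B nat_set g (fun S => @fibers_preimage nat g S Bg).
have pos_cofin : fin_cofin (~` [set 0%N]).
  by apply: fin_cofinC; exact: fin_cofin1.
rewrite (@trans_measure_preimage nat_set G _ _ pos_cofin); last first.
  by rewrite -[LHS]setCK -g0.
rewrite nneseries_esumT; last by move=> n; exact: ennval_ge0.
(* The successor is a bijection from all indices [n] onto the nonzero labels. *)
rewrite (@reindex_esum _ nat nat_set setT _ succn).
  apply: eq_esum => n _; rewrite -trans_measure_block.
  by congr (ennval (trans_measure _)); apply: val_inj => /=; rewrite gS.
by split=> [n _ //|m n _ _ []//|[|n] //= _]; exists n.
Qed.

Definition trans_premeasure : premeasure R B :=
  Premeasure trans_measure0 trans_measure_sigma_additive.

End premeasure_of_trans.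

End premeasure_strict_trans.

Theorem theorem6p2 (R : realType) (X : Type) (B : set (set X))
    (algB : set_algebra B) :
  exists tau : premeasure R B ->
      strict_trans (partition_functor B) (weight_functor R),
    (forall (mu : premeasure R B) (A : countable_set)
        (g : partition_functor B A),
      tau mu A g = premeasure_family mu g) /\
    poset_iso tau.
Proof.
exists (@premeasure_trans R X B); split=> //; split.
  move=> mu nu /asboolP mn; apply/asboolP => A g.
  by apply/lefP => a; exact: mn.
exists (trans_premeasure algB); split.
- move=> s t /asboolP st; apply/asboolP => E.
  (* The recovered premeasures at [E] are the [true] coordinates at its indicator, so the pointwise
     order passes to them. *)
  by have /lefP := st bool_set (indicator algB E); exact.
- move=> mu; apply: premeasure_ext => E.
  by rewrite /= /trans_measure /= /premeasure_family block_indicator.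
- move=> s; apply: strict_trans_ext => A g; apply/funext => a.
  exact: trans_measure_block.
Qed.
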